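(* For all integers $n,k\geq 0$, $$A_{n+k,k}=\sum_{r=0}^{n}\sum_{j=0}^{k}\binom{n}{r}V_{r}S(k,j)j^{n-r},\qquad A_{n+k,k}=\sum_{r=0}^{n}\sum_{j=0}^{k}\binom{n}{r}B_{r}S(k,j)(j-1)^{n-r}.$$
   Context: A partition of a finite set is a collection of nonempty, pairwise disjoint subsets (blocks) whose union is the set; a singleton of a partition is a block with exactly one element. $S(k,j)$ is the Stirling number of the second kind (number of partitions of $\{1,\dots,k\}$ into exactly $j$ blocks; $S(0,0)=1$). $B_n$ denotes the $n$-th Bell number ($B_0=1$), and $V_n$ the number of partitions of $\{1,\dots,n\}$ with no singletons ($V_0=1$). For integers $0\leq k\leq n$, $A_{n,k}$ denotes the number of partitions of $\{1,2,\dots,n+1\}$ whose largest singleton is $k+1$ (i.e. $\{k+1\}$ is a block and no $j>k+1$ forms a singleton block). The convention $0^0=1$ is used. *)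

(* Defs.v *)
From mathcomp Require Import all_boot all_order all_algebra.

Set Implicit Arguments.
Unset Strict Implicit.
Unset Printing Implicit Defensive.

(* The ground set {1, ..., n} is represented by 'I_n = {0, ..., n-1}: the
   ordinal i stands for the integer i + 1. *)

Definition set_partitions (n : nat) : {set {set {set 'I_n}}} :=
  [set P | partition P [set: 'I_n]].

Definition singleton_of (n : nat) (P : {set {set 'I_n}}) (i : 'I_n) : bool :=
  [set i] \in P.

Definition stirling2 (k j : nat) : nat :=
  #|[set P in set_partitions k | #|P| == j]|.

Definition bell (n : nat) : nat := #|set_partitions n|.

Definition no_singleton_count (n : nat) : nat :=
  #|[set P in set_partitions n | [forall i, ~~ singleton_of P i]]|.

(* With the shift of labels above, the largest singleton is k + 1 exactly when
   the largest i with [set i] \in P has value k. *)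
Definition largest_singleton_count (n k : nat) : nat :=
  #|[set P in set_partitions n.+1 |
      [exists i : 'I_n.+1,
        [&& nat_of_ord i == k, singleton_of P i &
            [forall j : 'I_n.+1, (i < j) ==> ~~ singleton_of P j]]]]|.

(* Main.v *)
Require Import Defs.
From mathcomp Require Import all_boot all_order all_algebra.
From mathcomp Require Import ring zify.
Set Implicit Arguments.
Unset Strict Implicit.
Unset Printing Implicit Defensive.
Import GRing.Theory.

(** Deleting the block {k+1} leaves a partition of K + N with |K| = k, |N| = n
    and no singleton inside N. Insert the elements of N one at a time into a
    partition of K with j blocks: the number u(n,j) of ways depends only on n
    and j, so A_{n+k,k} is the sum of S(k,j) u(n,j). Following the number of
    singletons that still have to be absorbed yields the recurrence
    u(n+1,j) = (j-1) u(n,j) + u(n,j+1). Hence V_r = u(r,0), B_r = u(r,1), and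
    u(n,.) is an Appell sequence, u(n,a+b) = sum_r C(n,r) u(r,a) b^(n-r),
    whose expansions at a = 0 and a = 1 are the two formulas. *)

(** * Counting insertions by good and bad blocks *)

(** Number of ways to insert [n] further elements into a partition with [j] good
    blocks and [s] bad ones so that no bad block remains: a block is bad when it
    is a singleton consisting of an inserted element. *)
Fixpoint completions (n j s : nat) : nat :=
  if n is m.+1 then
    j * completions m j s + s * completions m j.+1 s.-1 + completions m j s.+1
  else s == 0.

(* A good block either stays untouched or behaves as a bad one. *)
Lemma completions_bad_to_good n j s :
  completions n j.+1 s = completions n j s.+1 + completions n j s.
Proof.
elim: n j s => [|n IHn] j s /=; first by case: s.
case: s => [|s] /=; rewrite !IHn; ring.
Qed.

(** * Appell sequences and their addition formula *)

Section AppellTransform.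
Local Open Scope ring_scope.

(** Binomial convolution of [c] with the powers of [x]: umbrally $(c+x)^n$ with $c^r$ read as
    [c r]. *)
Definition appell (c : nat -> int) (n : nat) (x : int) : int :=
  \sum_(r < n.+1) 'C(n, r)%:Z * c r * x ^+ (n - r).

Lemma appell0 c x : appell c 0 x = c 0%N.
Proof. by rewrite /appell big_ord_recl big_ord0 bin0 mulr1 mul1r addr0. Qed.

(** Pascal's rule; umbrally $(c+x)^{n+1} = x(c+x)^n + c(c+x)^n$, where a factor $c$ shifts the
    sequence. *)
Lemma appell_recl c n x :
  appell c n.+1 x = x * appell c n x + appell (fun r => c r.+1) n x.
Proof.
rewrite /appell big_ord_recl /= [in RHS]big_ord_recl /= mulrDr -addrA.
congr (_ + _); first by rewrite !bin0 !subn0 exprS; ring.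
rewrite mulr_sumr big_ord_recr /= [in RHS]big_ord_recr /= addrA.
congr (_ + _); last by rewrite /bump /= !add1n binS bin_small // !subSS !binn.
rewrite -big_split /=; apply: eq_bigr => i _.
rewrite /bump /= !add1n binS PoszD subSS.
have -> : (n - i = (n - i.+1).+1)%N by have := ltn_ord i; lia.
by rewrite exprS; ring.
Qed.

Lemma eq_appell c d n x : c =1 d -> appell c n x = appell d n x.
Proof. by move=> e; apply: eq_bigr => r _; rewrite e. Qed.

Lemma appell_linear c d a n x :
  appell (fun r => a * c r + d r) n x = a * appell c n x + appell d n x.
Proof.
by rewrite /appell mulr_sumr -big_split; apply: eq_bigr => r _ /=; ring.
Qed.

Lemma appellD c n a b :
  appell (fun r => appell c r a) n b = appell c n (a + b).
Proof.
elim: n c => [|n IHn] c; first by rewrite !appell0.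
rewrite !appell_recl (eq_appell _ _ (fun r => appell_recl c r a)).
by rewrite appell_linear !IHn; ring.
Qed.

Definition safe_completions (j n : nat) : int := (completions n j 0)%:Z.

(** A new element opening a bad block leaves [completions n j 1], which [completions_bad_to_good]
    turns into $u(n,j+1)-u(n,j)$; hence the factor $j-1$. *)
Lemma safe_completionsS j n :
  safe_completions j n.+1
  = (j%:Z - 1) * safe_completions j n + safe_completions j.+1 n.
Proof.
by rewrite /safe_completions /= completions_bad_to_good !PoszD PoszM; ring.
Qed.

(** Choose the elements that join one distinguished good block; the others see only [j] good blocks.
    The induction checks that both sides obey the same recurrence. *)
Lemma appell_safe_completions1 j n :
  appell (safe_completions j) n 1 = safe_completions j.+1 n.
Proof.
elim: n j => [|n IHn] j; first by rewrite appell0.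
rewrite appell_recl (eq_appell _ _ (safe_completionsS j)) appell_linear !IHn.
by rewrite safe_completionsS intS; ring.
Qed.

Lemma appell_safe_completions j n :
  appell (safe_completions 0) n j%:Z = safe_completions j n.
Proof.
elim: j n => [|j IHj] n.
  (* At $x=0$ only the term $r=n$ survives, thanks to $0^0=1$. *)
  rewrite /appell big_ord_recr /= big1 ?add0r ?binn ?subnn ?mulr1 ?mul1r //.
  move=> i _; have -> : (n - i = (n - i.+1).+1)%N by have := ltn_ord i; lia.
  by rewrite exprS mul0r mulr0.
rewrite intS addrC -appellD -appell_safe_completions1.
exact: eq_appell.
Qed.

End AppellTransform.

(** * Adding one element to a partition *)

Section PartitionExtension.
Variables (T : finType) (x : T) (D : {set T}).
Hypothesis xD : x \notin D.
Implicit Types (P Q : {set {set T}}) (B : {set T}).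

Lemma partition_notin_block Q B : partition Q D -> B \in Q -> x \notin B.
Proof. by move=> pQ QB; apply: contra xD; apply/subsetP/(partitionS pQ QB). Qed.

Lemma partition_notin Q B : partition Q D -> x \in B -> B \notin Q.
Proof. by move=> pQ Bx; apply: contraL Bx; apply: partition_notin_block pQ. Qed.

Lemma partition_addU1 Q : partition Q D -> partition ([set x] |: Q) (x |: D).
Proof.
move=> pQ; apply: partitionU1 pQ _ _; last by rewrite disjoints1.
by apply/set0Pn; exists x; rewrite inE.
Qed.

Lemma partition_insert Q B : partition Q D -> B \in Q ->
  partition ((x |: B) |: (Q :\ B)) (x |: D).
Proof.
move=> pQ QB; have sBD := partitionS pQ QB.
have -> : x |: D = (x |: B) :|: (D :\: B).
  apply/setP => y; rewrite !inE -orbA; congr (_ || _).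
  by case yB: (y \in B); rewrite //= (subsetP sBD).
apply: partitionU1; first exact: partitionD1.
  by apply/set0Pn; exists x; rewrite !inE eqxx.
rewrite -setI_eq0; apply/eqP/setP => y; rewrite !inE.
by case: (eqVneq y x) => [->|_]; rewrite ?(negbTE xD) ?andbF //=; case: (y \in B).
Qed.

(** Deleting [x] from a partition is reversible once it is known whether [x] was alone or which
    block [B] it had joined. *)
Lemma sum_partitionU1 (F : {set {set T}} -> nat) :
  \sum_(P | partition P (x |: D)) F P
  = \sum_(Q | partition Q D)
      (F ([set x] |: Q) + \sum_(B in Q) F ((x |: B) |: (Q :\ B))).
Proof.
rewrite big_split /= (bigID (fun P => [set x] \in P)) /=; congr (_ + _).
  rewrite (reindex_onto (fun Q => [set x] |: Q) (fun P => P :\ [set x])) /=;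
    last by move=> P /andP[_ xP]; rewrite setD1K.
  apply: eq_bigl => Q; rewrite setU11 andbT; apply/andP/idP => [[pP /eqP eQ]|pQ].
    have := partitionD1 pP (setU11 _ _); rewrite eQ.
    by rewrite setU1K.
  by rewrite partition_addU1 // setU1K ?eqxx // (partition_notin pQ) ?inE.
rewrite pair_big_dep /=.
rewrite (reindex_onto
  (fun p : {set {set T}} * {set T} => (x |: p.2) |: (p.1 :\ p.2))
  (fun P => ((pblock P x :\ x) |: (P :\ pblock P x), pblock P x :\ x))) /=;
  last first.
  move=> P /andP[pP xP].
  have cx : x \in cover P by rewrite (cover_partition pP) setU11.
  have Bx : x \in pblock P x by rewrite mem_pblock.
  have PB := pblock_mem cx.
  rewrite setD1K // setU1K ?setD1K //.
  (* Were the block of [x] minus [x] also a block, any of its points would lie in two distinct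
     blocks. *)
  rewrite in_setD1; apply/negP => /andP[nB PB'].
  have tP := partition_trivIset pP.
  have /set0Pn[y yB] := partition_neq0 pP PB'.
  have e1 := def_pblock tP PB' yB.
  have e2 : pblock P y = pblock P x by apply: def_pblock; rewrite // -?in_setD1; case/setD1P: yB.
  by move: nB; rewrite -e1 e2 eqxx.
apply: eq_bigl => -[Q B] /=; apply/andP/andP => [[/andP[pP xP] /eqP e]|[pQ QB]].
  set P := _ |: _ in pP xP e.
  have PB : x |: B \in P by rewrite setU11.
  have eB : pblock P x = x |: B.
    by rewrite (def_pblock (partition_trivIset pP) PB) // setU11.
  case: e; rewrite eB => eQ eB'.
  have xB : x \notin B by rewrite -eB' !inE eqxx.
  rewrite eB' in eQ; rewrite -eQ setU11; split=> //.
  have pP1 := partitionD1 pP PB.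
  have B0 : B != set0.
    by apply: contraNneq xP => B0; rewrite -(setU0 [set x]) -B0.
  have -> : D = B :|: ((x |: D) :\: (x |: B)).
    have sBD : B \subset D.
      have /subsetP s := partitionS pP PB; apply/subsetP => y yB.
      have := s y; rewrite !inE yB orbT => /(_ isT)/predU1P[e|//].
      by rewrite -e yB in xB.
    apply/setP => y; rewrite !inE; case: (eqVneq y x) => [->|_] /=.
      by rewrite (negbTE xB) (negbTE xD).
    by case yB: (y \in B); rewrite //= (subsetP sBD).
  apply: partitionU1 pP1 B0 _; rewrite -setI_eq0; apply/eqP/setP => y.
  by rewrite !inE; case: (y \in B); rewrite ?orbT ?andbF.
have xB := partition_notin_block pQ QB; have pP := partition_insert pQ QB.
have PB : x |: B \in (x |: B) |: (Q :\ B) by rewrite setU11.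
have eB : pblock ((x |: B) |: (Q :\ B)) x = x |: B.
  by rewrite (def_pblock (partition_trivIset pP) PB) // setU11.
have nQ : x |: B \notin Q :\ B.
  by rewrite in_setD1 negb_and (partition_notin pQ) ?setU11 ?orbT.
rewrite eB setU1K // setU1K // setD1K // eqxx; split=> //.
rewrite pP !inE negb_or negb_and (partition_notin pQ) ?inE // orbT andbT.
(* It remains to see that [x |: B] is not $\{x\}$: a point of [B] differs from [x]. *)
have /set0Pn[y yB] := partition_neq0 pQ QB.
apply: contraNneq xB => /setP/(_ y); rewrite !inE yB orbT => /eqP <- //.
Qed.

Lemma sum_partitionU1_card (f : nat -> nat) :
  \sum_(P | partition P (x |: D)) f #|P|
  = \sum_(Q | partition Q D) (#|Q| * f #|Q| + f #|Q|.+1).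
Proof.
rewrite sum_partitionU1; apply: eq_bigr => Q pQ.
rewrite cardsU1 (partition_notin pQ) ?inE // addnC; congr (_ + _).
rewrite (eq_bigr (fun=> f #|Q|)) ?sum_nat_const // => B QB.
rewrite cardsU1 in_setD1 (negbTE (partition_notin pQ _)) ?setU11 // andbF.
by rewrite (cardsD1 B Q) QB.
Qed.

Section BadBlocks.
Variable M : {set T}.
Hypothesis sMD : M \subset D.
(** [M] holds the elements inserted so far, so [Q :&: S] is the set of bad blocks of [Q] and
    [Q :\: S] that of good ones. *)
Let S := set1 @: M.
Let Sx := set1 @: (x |: M).

Lemma bad_blocksU1 : Sx = [set x] |: S.
Proof. by rewrite /Sx imsetU1. Qed.

Lemma notin_bad B : x \in B -> B \notin S.
Proof.
move=> Bx; apply/imsetP => -[y yM e]; move: Bx; rewrite e inE => /eqP exy.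
by move: xD; rewrite exy (subsetP sMD).
Qed.

(** One step of [completions]: joining a good block changes neither count, joining a bad block makes
    it good, and a new singleton is bad. *)
Lemma sum_partitionU1_bad (f : nat -> nat -> nat) :
  \sum_(P | partition P (x |: D)) f #|P :\: Sx| #|P :&: Sx|
  = \sum_(Q | partition Q D)
      (let j := #|Q :\: S| in let s := #|Q :&: S| in
       j * f j s + s * f j.+1 s.-1 + f j s.+1).
Proof.
rewrite sum_partitionU1; apply: eq_bigr => Q pQ /=.
rewrite bad_blocksU1 addnC; congr (_ + _); last first.
  have xQ : [set x] \notin Q by rewrite (partition_notin pQ) ?inE.
  rewrite -setUIr cardsU1 inE (negbTE xQ) /=; congr (f _ _).
  apply: eq_card => B; rewrite !inE; case: eqP => [->|] //=.
  by rewrite (negbTE xQ) andbF.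
(* The enlarged block [x |: B] is always good: it is not $\{x\}$, and it contains [x], which is
   outside [M]. *)
have insert_cards B : B \in Q ->
    #|((x |: B) |: (Q :\ B)) :\: ([set x] |: S)| = #|(Q :\: S) :\ B|.+1
    /\ #|((x |: B) |: (Q :\ B)) :&: ([set x] |: S)| = #|(Q :&: S) :\ B|.
  move=> QB.
  have BxS : x |: B \notin S by rewrite notin_bad ?setU11.
  have BxQ : x |: B \notin Q by rewrite (partition_notin pQ) ?setU11.
  have xQ : [set x] \notin Q by rewrite (partition_notin pQ) ?inE.
  have Bx1 : x |: B != [set x].
    have /set0Pn[y yB] := partition_neq0 pQ QB.
    apply: contraNneq (partition_notin_block pQ QB) => /setP/(_ y).
    by rewrite !inE yB orbT => /esym/eqP <-.
  split; last first.
    apply: eq_card => C; rewrite !inE.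
    case: (eqVneq C (x |: B)) => [->|_] /=.
      by rewrite (negbTE BxS) (negbTE Bx1) !andbF.
    case: (eqVneq C [set x]) => [->|_] /=; first by rewrite (negbTE xQ) !andbF.
    by rewrite andbA.
  have -> : ((x |: B) |: (Q :\ B)) :\: ([set x] |: S)
            = (x |: B) |: ((Q :\: S) :\ B).
    apply/setP => C; rewrite !inE.
    case: (eqVneq C (x |: B)) => [->|_] /=.
      by rewrite (negbTE BxS) (negbTE Bx1).
    case: (eqVneq C [set x]) => [->|_] /=; first by rewrite (negbTE xQ) !andbF.
    by rewrite andbCA.
  by rewrite cardsU1 !inE (negbTE BxQ) !andbF.
rewrite (bigID (mem S)) /= addnC; congr (_ + _).
  rewrite (eq_bigr (fun=> f #|Q :\: S| #|Q :&: S|)).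
    rewrite sum_nat_const; congr (_ * _).
    by apply: eq_card => B; rewrite !inE andbC.
  move=> B /andP[QB SB]; have [-> ->] := insert_cards B QB.
  rewrite (cardsD1 B (Q :\: S)) (cardsD1 B (Q :&: S)) !inE QB.
  by rewrite (negbTE SB).
rewrite (eq_bigr (fun=> f #|Q :\: S|.+1 #|Q :&: S|.-1)).
  rewrite sum_nat_const; congr (_ * _).
  by apply: eq_card => B; rewrite !inE.
move=> B /andP[QB SB]; have [-> ->] := insert_cards B QB.
rewrite (cardsD1 B (Q :\: S)) (cardsD1 B (Q :&: S)) !inE QB.
by have -> : B \in S by [].
Qed.

End BadBlocks.
End PartitionExtension.

(** * Iterating the insertion over a finite set *)

Section Counting.
Variable T : finType.
Implicit Types (D M N : {set T}).

(** The sum depends on [D] only through its size. Evaluation is at 0 because the partition of the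
    empty set has no block. *)
Lemma sum_partition_card (f : nat -> nat) D :
  \sum_(P | partition P D) f #|P|
  = iter #|D| (fun g j => j * g j + g j.+1) f 0.
Proof.
move cD: #|D| => n; elim: n D cD f => [|n IHn] D cD f.
  move/eqP: cD; rewrite cards_eq0 => /eqP->.
  under eq_bigl do rewrite partition_set0.
  by rewrite big_pred1_eq cards0.
have /card_gt0P[x xD] : 0 < #|D| by rewrite cD.
have xD' : x \notin D :\ x by rewrite !inE eqxx.
rewrite -(setD1K xD) (sum_partitionU1_card xD') iterSr -(IHn (D :\ x)) //.
by apply/eqP; rewrite -eqSS -cD (cardsD1 x D) xD.
Qed.

Lemma count_no_new_singleton N D M :
    [disjoint N & D] -> M \subset D ->
  \sum_(P | partition P (N :|: D)) (P :&: set1 @: (N :|: M) == set0)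
  = \sum_(Q | partition Q D)
      completions #|N| #|Q :\: set1 @: M| #|Q :&: set1 @: M|.
Proof.
move cN: #|N| => n; elim: n N cN D M => [|n IHn] N cN D M dND sMD.
  move/eqP: cN; rewrite cards_eq0 => /eqP->; rewrite !set0U.
  by apply: eq_bigr => P _ /=; rewrite cards_eq0.
have /card_gt0P[x xN] : 0 < #|N| by rewrite cN.
have xD' : x \notin D by rewrite (disjointFr dND).
(* Move [x] from [N] into both [D] and [M]; the unions with [N] do not change. *)
rewrite /= -(sum_partitionU1_bad xD' sMD (completions n)) -(IHn (N :\ x)).
- have moveU A : (N :\ x) :|: (x |: A) = N :|: A.
    by rewrite setUA [_ :|: [set x]]setUC setD1K.
  by rewrite !moveU.
- by apply/eqP; rewrite -eqSS -cN (cardsD1 x N) xN.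
- rewrite disjoint_sym -setI_eq0 setIUl setU_eq0 !setI_eq0 disjoints1 !inE eqxx /=.
  rewrite disjoint_sym; apply: disjointWl dND; exact: subD1set.
- exact: setUS.
Qed.

End Counting.

(** * Stirling, Bell and singleton counts through completions *)

Lemma stirling2_sum (T : finType) (D : {set T}) (f : nat -> nat) :
  \sum_(P | partition P D) f #|P|
  = \sum_(0 <= j < #|D|.+1) stirling2 #|D| j * f j.
Proof.
(* Both sums depend only on the size of the ground set, so [D] may be replaced by ['I_#|D|] without
   a bijection. *)
rewrite sum_partition_card -{1}(card_ord #|D|) -cardsT -sum_partition_card.
have lt_card (P : {set {set 'I_#|D|}}) : partition P setT -> #|P| < #|D|.+1.
  move=> pP; rewrite ltnS -[leqRHS]card_ord -cardsT (card_partition pP).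
  rewrite -sum1_card; apply: leq_sum => B PB.
  by rewrite card_gt0 (partition_neq0 pP).
rewrite big_mkord.
rewrite (partition_big
  (fun P : {set {set 'I_#|D|}} => inord #|P| : 'I_#|D|.+1) predT) //=.
apply: eq_bigr => j _.
rewrite (eq_bigr (fun=> f j)) => [|P /andP[pP /eqP <-]]; last first.
  by rewrite inordK ?lt_card.
rewrite sum_nat_const; congr (_ * _); apply: eq_card => P; rewrite !inE.
rewrite unfold_in; case pP: (partition _ _) => //=.
by rewrite -val_eqE /= inordK ?lt_card.
Qed.

(** Gathering all singletons into one extra good block leaves no bad block. In the proof, the
    iterates at $j$ satisfy the recurrence of $u(n,j+1)$. *)
Lemma bell_completions n : bell n = completions n 1 0.
Proof.
rewrite /bell -sum1_card.
under eq_bigl do rewrite inE.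
rewrite (sum_partition_card (fun=> 1)) cardsT card_ord.
suff -> j : iter n (fun g j => j * g j + g j.+1) (fun=> 1) j
            = completions n j.+1 0 by [].
elim: n j => [|n IHn] j //=; rewrite !IHn.
by rewrite (completions_bad_to_good n j.+1); ring.
Qed.

Lemma no_singleton_blocks (T : finType) (M : {set T}) (P : {set {set T}}) :
  (P :&: set1 @: M == set0) = [forall x in M, [set x] \notin P].
Proof.
apply/eqP/forall_inP => [e x xM|h].
  apply/negP => Px; have : [set x] \in P :&: set1 @: M by rewrite inE Px imset_f.
  by rewrite e inE.
apply/setP => B; rewrite !inE; apply/negP => /andP[PB /imsetP[x xM e]].
by move/negP: (h x xM); rewrite -e.
Qed.

Lemma no_singleton_count_completions n :
  no_singleton_count n = completions n 0 0.
Proof.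
have := @count_no_new_singleton 'I_n setT set0 set0.
rewrite -setI_eq0 setI0 eqxx sub0set !setU0 => /(_ isT isT).
under [RHS]eq_bigl do rewrite partition_set0.
rewrite big_pred1_eq set0D set0I cards0 cardsT card_ord => <-.
rewrite /no_singleton_count -sum1_card big_mkcond [RHS]big_mkcond /=.
apply: eq_bigr => P _; rewrite !inE no_singleton_blocks.
case: (partition _ _) => //=.
rewrite (_ : [forall x in setT, _] = [forall i, ~~ singleton_of P i]);
  first by case: ifP.
by apply: eq_forallb => i; rewrite inE.
Qed.

Lemma largest_singleton_count_completions n k :
  largest_singleton_count (n + k) k
  = \sum_(0 <= j < k.+1) stirling2 k j * completions n j 0.
Proof.
(* [x] stands for the integer $k+1$; [K] and [N] are the elements below and above it. *)
have lt_k : k < (n + k).+1 by rewrite ltnS leq_addl.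
pose x := Ordinal lt_k.
pose K := [set i : 'I_(n + k).+1 | i < k].
pose N := [set i : 'I_(n + k).+1 | k < i].
have cK : #|K| = k.
  have widen_inj : injective (widen_ord (ltnW lt_k)).
    by move=> i j /(congr1 val) /= /val_inj.
  rewrite -[RHS]card_ord -(card_imset _ widen_inj).
  apply: eq_card => i; rewrite inE; apply/idP/imsetP => [ik|[j _ ->] /=].
    by exists (Ordinal ik) => //; apply: val_inj.
  exact: ltn_ord.
have xNK : x \notin N :|: K by rewrite !inE /= ltnn.
have dNK : [disjoint N & K].
  by rewrite -setI_eq0; apply/eqP/setP => i; rewrite !inE; lia.
have allE : x |: (N :|: K) = setT.
  by apply/setP => i; rewrite !inE -val_eqE /=; lia.
have cN : #|N| = n.
  have := congr1 (fun A => #|pred_of_set A|) allE.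
  rewrite cardsU1 xNK cardsU (disjoint_setI0 dNK) cards0 cK cardsT card_ord; lia.
transitivity (\sum_(P | partition P (x |: (N :|: K)))
   (([set x] \in P) && (P :&: set1 @: (N :|: set0) == set0) : nat)).
  rewrite /largest_singleton_count -sum1_card big_mkcond [RHS]big_mkcond /=.
  apply: eq_bigr => P _; rewrite allE inE [_ \in set_partitions _]inE.
  case: (partition _ _) => //=; rewrite setU0 no_singleton_blocks.
  set a := [exists i, _]; set b := _ && _; suff -> : a = b by case: b.
  rewrite /a /b; apply/existsP/andP => [[i /and3P[/eqP ik Pi /forallP h]]|[Px h]].
    have ix : i = x by apply: val_inj.
    rewrite {}ix in Pi h; split=> //; apply/forall_inP => j; rewrite inE.
    exact: (implyP (h j)).
  exists x; rewrite /= eqxx /singleton_of Px /=; apply/forallP => j; apply/implyP => kj.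
  by apply: (forall_inP h); rewrite inE.
rewrite sum_partitionU1 //.
(* Only the extensions having $\{x\}$ as a block contribute; joining [x] to a block yields 0. *)
transitivity (\sum_(Q | partition Q (N :|: K))
   (Q :&: set1 @: (N :|: set0) == set0)).
  apply: eq_bigr => Q pQ; rewrite big1 ?addn0 => [|B QB].
    rewrite setU11 /= setU0 setIUl (_ : [set [set x]] :&: _ = set0) ?set0U //.
    apply/setP => B; rewrite !inE; apply/andP => -[/eqP-> /imsetP[y yN]].
    by move/set1_inj => e; move: yN; rewrite -e inE ltnn.
  rewrite !inE (negbTE (partition_notin xNK pQ _)) ?inE // andbF orbF.
  case: eqP => //= /setP e; have /set0Pn[y yB] := partition_neq0 pQ QB.
  have := partition_notin_block xNK pQ QB.
  by have := e y; rewrite !inE yB orbT => /eqP <-; rewrite yB.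
rewrite count_no_new_singleton ?sub0set //.
have := stirling2_sum K (fun j => completions n j 0); rewrite cK => <-.
(* With [M] empty, all blocks on [K] start good, even singletons. *)
by apply: eq_bigr => Q _; rewrite imset0 setI0 setD0 cards0 cN.
Qed.

(** * The two expansions *)

Local Open Scope ring_scope.

Lemma largest_singleton_count_appell n k :
  (largest_singleton_count (n + k) k)%:Z
  = \sum_(0 <= j < k.+1)
      (stirling2 k j)%:Z * appell (safe_completions 0) n j%:Z.
Proof.
rewrite largest_singleton_count_completions -natz natr_sum.
by apply: eq_bigr => j _; rewrite appell_safe_completions natrM !natz.
Qed.

Lemma sum_appell (c a x : nat -> int) n k :
  \sum_(0 <= j < k) a j * appell c n (x j)
  = \sum_(0 <= r < n.+1) \sum_(0 <= j < k)
      'C(n, r)%:Z * c r * a j * x j ^+ (n - r).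
Proof.
rewrite exchange_big /=; apply: eq_bigr => j _.
rewrite big_mkord /appell mulr_sumr; apply: eq_bigr => r _; ring.
Qed.

Local Close Scope ring_scope.

Theorem theorem2p7 (n k : nat) :
  largest_singleton_count (n + k) k
    = (\sum_(0 <= r < n.+1) \sum_(0 <= j < k.+1)
         'C(n, r) * no_singleton_count r * stirling2 k j * j ^ (n - r))%N
  /\
  ((largest_singleton_count (n + k) k)%:Z
    = \sum_(0 <= r < n.+1) \sum_(0 <= j < k.+1)
        ('C(n, r))%:Z * (bell r)%:Z * (stirling2 k j)%:Z
          * (j%:Z - 1) ^+ (n - r))%R.
Proof.
split; last first.
  rewrite largest_singleton_count_appell.
  (* Splitting $j = 1+(j-1)$ moves the base point of the expansion from 0 to 1, giving Bell
     coefficients. At $j=0$ the increment is $-1$, hence integers. *)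
  have shift1 (j : nat) : (j%:Z = 1 + (j%:Z - 1))%R by ring.
  under eq_bigr => j _ do rewrite (shift1 j) -appellD.
  rewrite sum_appell; apply: eq_bigr => r _; apply: eq_bigr => j _.
  by rewrite bell_completions appell_safe_completions1.
apply/eqP; rewrite -eqz_nat; apply/eqP.
rewrite largest_singleton_count_appell sum_appell -[RHS]natz natr_sum.
apply: eq_bigr => r _; rewrite natr_sum; apply: eq_bigr => j _.
by rewrite no_singleton_count_completions !natrM natrX !natz.
Qed.
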